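(* Suppose that there exists a finite projective plane $\Pi_q$ of order $q>4$. Then there exists a bipartite $$egr\bigl(2(q-1)^2,\, q-2,\, 6,\, (q-3)(q^2-9q+21)\bigr).$$
   Context: All graphs are simple, finite and connected. A $(k,g)$-graph is a $k$-regular graph of girth $g$. An edge-girth-regular graph $egr(n,k,g,\lambda)$ is a $(k,g)$-graph on $n$ vertices in which every edge is contained in exactly $\lambda$ distinct cycles of length $g$. *)

(* Defs.v *)
From HB Require Import structures.
From mathcomp Require Import all_boot.

Set Implicit Arguments.
Unset Strict Implicit.
Unset Printing Implicit Defensive.

Section ProjectivePlane.
Variables (P L : finType) (inc : P -> L -> bool).

Record projective_plane : Prop := ProjectivePlane {
  plane_join : forall p1 p2 : P, p1 != p2 -> exists! l : L, inc p1 l /\ inc p2 l;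
  plane_meet : forall l1 l2 : L, l1 != l2 -> exists! p : P, inc p l1 /\ inc p l2;
  (* there are four points, no three of which are collinear *)
  plane_quadrangle : exists Q : {set P},
    #|Q| = 4 /\ forall l : L, #|[set p in Q | inc p l]| <= 2
}.

Definition plane_order (q : nat) : Prop :=
  forall l : L, #|[set p | inc p l]| = q.+1.

End ProjectivePlane.

Section Graph.
Variables (V : finType) (e : rel V).

Definition simple_graph : Prop := symmetric e /\ irreflexive e.

Definition connected_graph : Prop := forall x y : V, connect e x y.

Definition regular_graph (k : nat) : Prop := forall x : V, #|[set y | e x y]| = k.

Definition bipartite : Prop :=
  exists A : {set V}, forall x y : V, e x y -> (x \in A) != (y \in A).

(* [ucycleb] alone also accepts the empty sequence and [:: x; y] for an edge
   x y, which are not cycles of a simple graph. *)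
Definition graph_cycle (c : seq V) : bool := ucycleb e c && (2 < size c).

Definition has_girth (g : nat) : Prop :=
  (exists2 c : seq V, graph_cycle c & size c = g) /\
  (forall c : seq V, graph_cycle c -> g <= size c).

Definition cycle_edges (c : seq V) : {set {set V}} :=
  [set [set x; next c x] | x in c].

(* A cycle is counted as a subgraph, hence through its set of edges: the 2g
   rotations and reflections of a vertex sequence give the same cycle. *)
Definition cycles_of_length (g : nat) : {set {set {set V}}} :=
  [set cycle_edges (val c) | c : g.-tuple V & graph_cycle (val c)].

Record edge_girth_regular (n k g lambda : nat) : Prop := EdgeGirthRegular {
  egr_simple : simple_graph;
  egr_connected : connected_graph;
  egr_card : #|V| = n;
  egr_regular : regular_graph k;
  egr_girth : has_girth g;
  egr_lambda : forall x y : V, e x y ->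
    #|[set C in cycles_of_length g | [set x; y] \in C]| = lambda
}.

End Graph.

(* Main.v *)
Require Import Defs.
From HB Require Import structures.
From mathcomp Require Import all_boot zify.

Set Implicit Arguments.
Unset Strict Implicit.
Unset Printing Implicit Defensive.

(** Delete from the plane every point on the sides of a triangle ABC and every
    line through one of its vertices; the graph is the incidence graph of the
    (q-1)^2 points and (q-1)^2 lines that remain (the good ones).  Since two
    points lie on at most one line, there is no cycle shorter than 6, and the
    hexagons through a flag (p, l) correspond to the pairs (r, s) with r <> p
    one of the q-3 other good points of l and s a good point off l joined to p
    and r by good lines.  Any pair of good lines through p and r, both
    different from l, meets in a point s of the plane: this gives (q-3)^2
    points s.  Those lying on the side a are the q+1 points of a except B, C
    and the traces on a of l, pA and rA, so each side accounts for q-4 of them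
    and (q-3)^2 - 3(q-4) = q^2 - 9q + 21 points s are good. *)

(** * Cycles through an edge, counted as vertex sequences with a prescribed start *)

Lemma set2_inj (T : finType) (x y z w : T) :
  [set x; y] = [set z; w] -> (x = z /\ y = w) \/ (x = w /\ y = z).
Proof.
move=> E.
have: x \in [set z; w] by rewrite -E set21.
have: y \in [set z; w] by rewrite -E set22.
have: z \in [set x; y] by rewrite E set21.
have: w \in [set x; y] by rewrite E set22.
by do 4!case/set2P=> ?; subst; auto.
Qed.

Section Cycles.
Variables (V : finType) (e : rel V).

Lemma cycle_edges_rot n (c : seq V) : uniq c -> cycle_edges (rot n c) = cycle_edges c.
Proof.
move=> uc; apply/setP=> E; apply/imsetP/imsetP=> -[z zc ->]; exists z;
  by rewrite ?mem_rot ?next_rot // -(mem_rot n).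
Qed.

Lemma cycle_edges_rev (c : seq V) : uniq c -> cycle_edges (rev c) = cycle_edges c.
Proof.
move=> uc; apply/setP=> E; apply/imsetP/imsetP=> -[z zc ->].
  exists (prev c z); first by rewrite mem_prev -mem_rev.
  by rewrite next_rev // next_prev // setUC.
exists (next c z); first by rewrite mem_rev mem_next.
by rewrite next_rev // prev_next // setUC.
Qed.

Lemma graph_cycle_rot n (c : seq V) : graph_cycle e (rot n c) = graph_cycle e c.
Proof. by rewrite /graph_cycle /ucycleb rot_cycle rot_uniq size_rot. Qed.

Lemma graph_cycle_rev (c : seq V) :
  symmetric e -> graph_cycle e (rev c) = graph_cycle e c.
Proof.
move=> se; rewrite /graph_cycle /ucycleb rev_cycle rev_uniq size_rev.
by rewrite (@eq_cycle _ _ e).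
Qed.

Lemma graph_cycle_uniq (c : seq V) : graph_cycle e c -> uniq c.
Proof. by case/andP=> /andP[]. Qed.

Lemma next_cycle_nth (x0 : V) (c : seq V) i :
  uniq c -> i.+1 < size c -> next c (nth x0 c i) = nth x0 c i.+1.
Proof.
move=> uc hi; rewrite next_nth mem_nth 1?ltnW // index_uniq 1?ltnW //.
by case: c uc hi => //= y s _ hi; apply: set_nth_default.
Qed.

Lemma rotate_cycle (c : seq V) z : graph_cycle e c -> z \in c ->
  exists d, [/\ graph_cycle e d, size d = size c, cycle_edges d = cycle_edges c
            & take 2 d = [:: z; next c z]].
Proof.
move=> hc zc; have uc := graph_cycle_uniq hc; have [n s E] := rot_to zc.
exists (rot n c); split.
- by rewrite graph_cycle_rot.
- by rewrite size_rot.
- exact: cycle_edges_rot.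
- rewrite -(next_rot n uc).
  have: 2 < size (rot n c) by rewrite size_rot; case/andP: hc.
  by rewrite E; case: s {E} => [|y s] //= _; rewrite eqxx take0.
Qed.

(** A rotation suffices when [c] runs from [x] to [y]; when it runs from [y] to [x], the sequence is
    reversed first. *)
Lemma orient_cycle (c : seq V) x y : symmetric e -> graph_cycle e c ->
  [set x; y] \in cycle_edges c ->
  exists d, [/\ graph_cycle e d, size d = size c, cycle_edges d = cycle_edges c
            & take 2 d = [:: x; y]].
Proof.
move=> se hc /imsetP[z zc /set2_inj[] [-> ->]]; first exact: rotate_cycle.
have uc := graph_cycle_uniq hc.
have [||d [d1 d2 d3 d4]] := @rotate_cycle (rev c) (next c z).
- by rewrite graph_cycle_rev.
- by rewrite mem_rev mem_next.
exists d; split=> //.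
- by rewrite d2 size_rev.
- by rewrite d3 cycle_edges_rev.
- by rewrite d4 next_rev // prev_next.
Qed.

(** The first two vertices fix both the starting point and the direction, so the edge set determines
    every later vertex in turn. *)
Lemma cycle_edges_inj (c d : seq V) x y :
  uniq c -> uniq d -> size c = size d ->
  take 2 c = [:: x; y] -> take 2 d = [:: x; y] ->
  cycle_edges c = cycle_edges d -> c = d.
Proof.
move=> uc ud scd tc td E.
(* The invariant covers two consecutive positions, because excluding a step backwards needs the
   previous vertex. *)
have H i : i.+1 < size c ->
    nth x c i = nth x d i /\ nth x c i.+1 = nth x d i.+1.
  elim: i => [|i IH] hi.
    by move: tc td; case: (c) (d) => [|? [|? ?]] [|? [|? ?]] //= [-> -> _] [-> -> _].
  have [Ei Ei1] := IH (ltnW hi); split=> //.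
  have: [set nth x c i.+1; nth x c i.+2] \in cycle_edges d.
    rewrite -E; apply/imsetP; exists (nth x c i.+1); first by rewrite mem_nth // ltnW.
    by rewrite next_cycle_nth.
  case/imsetP=> z zd /set2_inj[] [E1 E2].
    by rewrite E2 -E1 Ei1 next_cycle_nth // -scd.
  (* walking backwards would revisit the vertex just left *)
  have: nth x c i.+2 = nth x c i.
    rewrite E2 -(prev_next ud z) -E1 Ei1 Ei -next_cycle_nth -?scd ?prev_next //.
    exact: ltnW.
  by move/eqP; rewrite nth_uniq //; [rewrite eqn_leq ltnNge leqnSn /= ?andbF => // | do 2!apply: ltnW].
apply: (@eq_from_nth _ x) => // -[|i] hi.
  suff: 1 < size c by case/H.
  by move: (congr1 size tc); case: (c) => [|? []].
by case: (H i hi).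
Qed.

(** Among the rotations and reflections of a cycle through the edge, exactly one vertex sequence
    starts with [x, y]. This trades edge sets for tuples, which can be counted directly. *)
Lemma card_cycles_through g x y : symmetric e ->
  #|[set C in cycles_of_length e g | [set x; y] \in C]| =
  #|[set c : g.-tuple V | graph_cycle e c & take 2 c == [:: x; y]]|.
Proof.
move=> se; rewrite -[RHS](@card_in_imset _ _ (fun c : g.-tuple V => cycle_edges c)).
  congr #|pred_of_set _|; apply/setP=> C; rewrite inE; apply/andP/imsetP.
    case=> /imsetP[c]; rewrite inE => hc -> xyc.
    have [d [d1 d2 d3 d4]] := orient_cycle se hc xyc.
    have sd : size d == g by rewrite d2 size_tuple.
    by exists (Tuple sd); rewrite ?inE /= ?d1 ?d4 ?d3 ?eqxx.
  case=> c; rewrite inE => /andP[hc /eqP tc] ->; split.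
    by apply/imsetP; exists c; rewrite ?inE.
  apply/imsetP; exists x; first by apply: (@mem_take 2); rewrite tc inE eqxx.
  by case: (tval c) tc hc => [|? [|? ?]] //= [-> -> _]; rewrite eqxx.
move=> c d; rewrite !inE => /andP[hc /eqP tc] /andP[hd /eqP td] E.
apply: val_inj; apply: cycle_edges_inj E; try exact: graph_cycle_uniq; eauto.
by rewrite !size_tuple.
Qed.

End Cycles.

(** * Incidence graphs: girth and hexagons through a flag *)

Section Incidence.
Variables (P L : finType) (inc : P -> L -> bool).

Definition incidence_rel (u v : P + L) : bool :=
  match u, v with
  | inl p, inr l | inr l, inl p => inc p l
  | _, _ => false
  end.

Lemma incidence_sym : symmetric incidence_rel.
Proof. by case=> ? [] ?. Qed.

Lemma incidence_simple : simple_graph incidence_rel.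
Proof. by split; [exact: incidence_sym | case]. Qed.

Lemma incidence_bipartite : bipartite incidence_rel.
Proof.
exists [set v : P + L | if v is inl _ then true else false].
by case=> ? [] ? //; rewrite !inE.
Qed.

Lemma incidence_regular k :
  (forall p, #|[set l | inc p l]| = k) -> (forall l, #|[set p | inc p l]| = k) ->
  regular_graph incidence_rel k.
Proof.
move=> hp hl [p|l].
  rewrite -(hp p) -(card_imset _ (@inr_inj P L)); congr #|pred_of_set _|.
  apply/setP=> -[r|m]; rewrite inE /=; first by apply/esym/imsetP; case.
  by rewrite mem_imset ?inE //; exact: inr_inj.
rewrite -(hl l) -(card_imset _ (@inl_inj P L)); congr #|pred_of_set _|.
apply/setP=> -[r|m]; rewrite inE /=; last by apply/esym/imsetP; case.
by rewrite mem_imset ?inE //; exact: inl_inj.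
Qed.

Lemma incidence_connected :
  (forall l, exists p, inc p l) ->
  (forall p r, connect incidence_rel (inl p) (inl r)) ->
  connected_graph incidence_rel.
Proof.
move=> hl hp.
have hc u : exists p, connect incidence_rel u (inl p).
  case: u => [p|l]; first by exists p.
  by have [p pl] := hl l; exists p; apply: connect1.
move=> u v.
have [p up] := hc u; have [r vr] := hc v.
apply: connect_trans up (connect_trans (hp p r) _).
by rewrite (sym_connect_sym incidence_sym).
Qed.

Hypothesis linear : forall p1 p2 l1 l2,
  inc p1 l1 -> inc p1 l2 -> inc p2 l1 -> inc p2 l2 -> p1 = p2 \/ l1 = l2.

(** Odd lengths contradict the alternation of points and lines; a 4-cycle would be two points on two
    common lines. *)
Lemma incidence_girth_ge6 c : graph_cycle incidence_rel c -> 6 <= size c.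
Proof.
case/andP=> /andP[].
case: c => [|v1 [|v2 [|v3 [|v4 [|v5 [|v6 c]]]]]] //=.
- by case: v1 v2 v3 => ? [] ? [] ? //=; rewrite ?andbF.
- case: v1 v2 v3 v4 => [p|l] [p1|l1] [p2|l2] [p3|l3] //=; rewrite ?andbF ?andbT //.
    case/and4P=> i1 i2 i3 i4; rewrite !inE /= !negb_or => /andP[/andP[n1 _] n2] _.
    case: (linear i1 i4 i2 i3) => E; by [rewrite E eqxx in n1 | rewrite E eqxx in n2].
  case/and4P=> i1 i2 i3 i4; rewrite !inE /= !negb_or => /andP[/andP[n1 _] n2] _.
  case: (linear i1 i2 i4 i3) => E; by [rewrite E eqxx in n1 | rewrite E eqxx in n2].
- by case: v1 v2 v3 v4 v5 => ? [] ? [] ? [] ? [] ? //=; rewrite ?andbF.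
Qed.

Definition collinear p r := [exists l, inc p l && inc r l].

(** A hexagon [p, l, r, m, s, n] is determined by [r] and [s], since [m] and [n] must be the unique
    lines joining [s] to [r] and to [p]. *)
Lemma card_hexagons p l : inc p l ->
  #|[set c : 6.-tuple (P + L) | graph_cycle incidence_rel c
       & take 2 c == [:: inl p; inr l]]| =
  \sum_(r | (r != p) && inc r l)
     #|[set s | [&& ~~ inc s l, collinear p s & collinear r s]]|.
Proof.
move=> pl.
under eq_bigr do rewrite -sum1_card; under eq_bigr do under eq_bigl do rewrite inE.
rewrite pair_big_dep sum1_card -[RHS]cardsE /=.
(* The default [l] only makes [join] total; it is never reached on collinear pairs. *)
pose join r s := odflt l [pick m | inc r m && inc s m].
have joinP r s : collinear r s -> inc r (join r s) && inc s (join r s).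
  by rewrite /join; case: pickP => //= h0 /existsP[m]; rewrite h0.
pose f (z : P * P) : 6.-tuple (P + L) :=
  [tuple inl p; inr l; inl z.1; inr (join z.1 z.2); inl z.2; inr (join p z.2)].
rewrite -[RHS](@card_imset _ _ f); last first.
  by move=> [r s] [r' s'] /(congr1 val) /= [-> _ ->].
congr #|pred_of_set _|; apply/setP=> c; rewrite inE; apply/andP/imsetP; last first.
  case=> -[r s]; rewrite inE /= => /andP[/andP[rp rl] /and3P[sl cps crs]] ->; split=> //.
  have /andP[j1 j2] := joinP _ _ cps; have /andP[j3 j4] := joinP _ _ crs.
  have sp : s != p by apply: contraNneq sl => ->.
  have sr : s != r by apply: contraNneq sl => ->.
  have n1 : l != join r s by apply: contraNneq sl => {1}->.
  have n2 : l != join p s by apply: contraNneq sl => {1}->.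
  (* If the two joins coincided, that line would contain [p] and [r], hence be [l]. *)
  have n3 : join r s != join p s.
    apply: contraNneq n2 => E; move: j3; rewrite E => j3.
    by case: (linear pl j1 rl j3) => [E'|-> //]; rewrite E' eqxx in rp.
  rewrite /graph_cycle /ucycleb /= pl rl j1 j2 j3 j4 /= andbT !inE /=.
  rewrite !(inj_eq (@inl_inj P L), inj_eq (@inr_inj P L)).
  by rewrite !negb_or ![p == _]eq_sym [r == s]eq_sym rp sp sr n1 n2 n3.
case: c => -[|v1 [|v2 [|v3 [|v4 [|v5 [|v6 []]]]]]] //= sc [] /[swap].
case/eqP=> -> ->; case: v3 v4 v5 v6 sc => [r|?] [?|m] [s|?] [?|n] sc;
  rewrite /graph_cycle /ucycleb /= ?andbF //.
rewrite !andbT => /andP[/and5P[_ rl rm sm /andP[sn pn]]].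
rewrite !inE /= !(inj_eq (@inl_inj P L), inj_eq (@inr_inj P L)) !negb_or.
case/and4P=> /and3P[pr ps _] /andP[lm ln] /andP[rs _] mn.
have sl : ~~ inc s l.
  apply/negP=> sl; case: (linear rl rm sl sm) => E.
    by rewrite E eqxx in rs.
  by rewrite E eqxx in lm.
exists (r, s).
  rewrite inE unfold_in /= eq_sym pr rl sl /=.
  by apply/andP; split; apply/existsP; [exists n | exists m]; rewrite ?pn ?rm.
apply: val_inj => /=.
have /joinP /andP[a1 a2]: collinear r s by apply/existsP; exists m; rewrite rm.
have /joinP /andP[b1 b2]: collinear p s by apply/existsP; exists n; rewrite pn.
case: (linear rm a1 sm a2) => [E|<-]; first by rewrite E eqxx in rs.
by case: (linear pn b1 sn b2) => [E|<-]; first by rewrite E eqxx in ps.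
Qed.

End Incidence.

(** * Counting in finite sets and subtypes *)

(** Deleted elements are given as an explicit list, so each later count reduces to checking that
    they are distinct and belong to [S]. *)
Lemma card_notin_seq (T : finType) (S : {set T}) (s : seq T) :
  uniq s -> {subset s <= S} -> #|[set x in S | x \notin s]| = #|S| - size s.
Proof.
move=> us sS; rewrite -(card_uniqP us) -(cardsE (mem s)) -cardsDS.
  by apply: eq_card => x; rewrite !inE andbC.
by apply/subsetP=> x; rewrite inE; apply: sS.
Qed.

Lemma exists_notin_seq (T : finType) (S : {set T}) (s : seq T) :
  size s < #|S| -> exists2 x, x \in S & x \notin s.
Proof.
move=> sS; apply/subsetPn; apply: contraL sS => /subset_leq_card le_S.
by rewrite -leqNgt (leq_trans le_S) // card_size.
Qed.

(** The vertices of the graph form subtypes; this carries counts in the graph over to counts in the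
    plane. *)
Lemma card_sig_set (T : finType) (Q R : pred T) :
  #|[set x : {x | Q x} | R (val x)]| = #|[set x | Q x & R x]|.
Proof.
rewrite -(card_imset _ val_inj); congr #|pred_of_set _|.
apply/setP=> x; rewrite inE; apply/imsetP/andP.
  by case=> -[y Qy]; rewrite inE => Ry ->.
by case=> Qx Rx; exists (Sub x Qx); rewrite ?inE.
Qed.

(** * The triangle and its symmetries *)

(** Generic in [r], so that it yields good points from [inc] and good lines from the dual
    incidence. *)
Definition avoids (T U : Type) (r : T -> U -> bool) (a b c : U) (x : T) : bool :=
  [&& ~~ r x a, ~~ r x b & ~~ r x c].

Lemma avoids_rot (T U : Type) (r : T -> U -> bool) a b c x :
  avoids r b c a x = avoids r a b c x.
Proof. by rewrite /avoids; do 3!case: (r _ _). Qed.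

(* The axioms are invariant under exchanging points with lines and under
   rotating the triangle, so each fact below is needed for one side only. *)
Record triangle_in_plane (P L : finType) (inc : P -> L -> bool) (q : nat)
    (A B C : P) (a b c : L) : Prop := TriangleInPlane {
  tri_join : forall p r, exists l, inc p l && inc r l;
  tri_meet : forall l m, exists p, inc p l && inc p m;
  tri_linear : forall p r l m,
    inc p l -> inc p m -> inc r l -> inc r m -> p = r \/ l = m;
  tri_line : forall l, #|[set p | inc p l]| = q.+1;
  tri_pencil : forall p, #|[set l | inc p l]| = q.+1;
  tri_vertices : [&& inc A b, inc A c, inc B c, inc B a, inc C a & inc C b];
  tri_proper : [&& ~~ inc A a, ~~ inc B b & ~~ inc C c] }.

Local Notation dual inc := (fun l p => inc p l).

Lemma triangle_dual (P L : finType) (inc : P -> L -> bool) q A B C a b c :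
  triangle_in_plane inc q A B C a b c ->
  triangle_in_plane (dual inc) q a b c A B C.
Proof.
case=> j m lin l p v n; split=> //.
- by move=> l1 l2 p1 p2 *; apply/or_comm; apply: lin.
- by case/and5P: v => -> -> -> -> /andP[-> ->].
Qed.

Lemma triangle_rot (P L : finType) (inc : P -> L -> bool) q A B C a b c :
  triangle_in_plane inc q A B C a b c ->
  triangle_in_plane inc q B C A b c a.
Proof.
case=> j m lin l p v n; split=> //.
- by case/and5P: v => -> -> -> -> /andP[-> ->].
- by case/and3P: n => -> -> ->.
Qed.

(** * Good points and lines, and visibility with respect to one side or vertex *)

Section Triangle.
Variables (P L : finType) (inc : P -> L -> bool) (q : nat).
Variables (A B C : P) (a b c : L).
Hypothesis H : triangle_in_plane inc q A B C a b c.

Local Notation goodp := (avoids inc a b c).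
Local Notation goodl := (avoids (dual inc) A B C).

(** Collinearity by a good line, but for arbitrary points of the plane: points on the sides are
    first counted too, then removed. *)
Definition visible p s := [exists l, [&& goodl l, inc p l & inc s l]].

Lemma line_eq p r l m :
  p != r -> inc p l -> inc r l -> inc p m -> inc r m -> l = m.
Proof. by move=> /eqP pr pl rl pm rm; case: (tri_linear H pl pm rl rm). Qed.

Lemma point_eq l m p r :
  l != m -> inc p l -> inc p m -> inc r l -> inc r m -> p = r.
Proof. by move=> /eqP lm pl pm rl rm; case: (tri_linear H pl pm rl rm). Qed.

Let Ab : inc A b. Proof. by case/and5P: (tri_vertices H). Qed.
Let Ac : inc A c. Proof. by case/and5P: (tri_vertices H). Qed.
Let Bc : inc B c. Proof. by case/and5P: (tri_vertices H). Qed.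
Let Ba : inc B a. Proof. by case/and5P: (tri_vertices H). Qed.
Let Ca : inc C a. Proof. by case/and5P: (tri_vertices H) => _ _ _ _ /andP[]. Qed.
Let Cb : inc C b. Proof. by case/and5P: (tri_vertices H) => _ _ _ _ /andP[]. Qed.
Let Aa : ~~ inc A a. Proof. by case/and3P: (tri_proper H). Qed.
Let Bb : ~~ inc B b. Proof. by case/and3P: (tri_proper H). Qed.
Let Cc : ~~ inc C c. Proof. by case/and3P: (tri_proper H). Qed.

Lemma inc_neqp p r l : inc p l -> ~~ inc r l -> p != r.
Proof. by move=> pl; apply: contraNneq => <-. Qed.

Lemma inc_neql p l m : inc p l -> ~~ inc p m -> l != m.
Proof. by move=> pl; apply: contraNneq => <-. Qed.

(** A good line meets the three sides in three distinct points, since two sides share only a vertex;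
    q + 1 - 3 points remain. *)
Lemma card_good_on_line l : goodl l -> #|[set p | goodp p & inc p l]| = q - 2.
Proof.
case/and3P=> Al Bl Cl.
have [X /andP[Xl Xa]] := tri_meet H l a.
have [Y /andP[Yl Yb]] := tri_meet H l b.
have [Z /andP[Zl Zc]] := tri_meet H l c.
have la : a != l by exact: inc_neql Ba Bl.
have lb : b != l by exact: inc_neql Ab Al.
have lc : c != l by exact: inc_neql Ac Al.
transitivity #|[set p in [set p | inc p l] | p \notin [:: X; Y; Z]]|.
  apply: eq_card => p; rewrite !inE !negb_or andbC; case pl: (inc p l) => //=.
  congr [&& ~~ _, ~~ _ & ~~ _]; apply/idP/eqP => [h|-> //].
  - exact: point_eq la h pl Xa Xl.
  - exact: point_eq lb h pl Yb Yl.
  - exact: point_eq lc h pl Zc Zl.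
rewrite card_notin_seq ?(tri_line H) ?subSS //.
  rewrite /= !inE negb_or -andbA andbT; apply/and3P; split.
  - apply: contraNneq Cl => E; rewrite E in Xa.
    by rewrite (point_eq (inc_neql Ba Bb) Ca Cb Xa Yb).
  - apply: contraNneq Bl => E; rewrite E in Xa.
    by rewrite (point_eq (inc_neql Ca Cc) Ba Bc Xa Zc).
  - apply: contraNneq Al => E; rewrite E in Yb.
    by rewrite (point_eq (inc_neql Cb Cc) Ab Ac Yb Zc).
by move=> p; rewrite !inE => /or3P[] /eqP->.
Qed.

(* A good point is the intersection of a line through A and a line through B. *)
Lemma card_good_points : #|[set p | goodp p]| = (q - 1) ^ 2.
Proof.
(* [M] and [N] are the pencils at [A] and [B] without the two sides in each. *)
pose M := [set m in [set m | inc A m] | m \notin [:: b; c]].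
pose N := [set n in [set n | inc B n] | n \notin [:: a; c]].
have bc : b != c by exact: inc_neql Cb Cc.
have ac : a != c by exact: inc_neql Ca Cc.
have AB : A != B by exact: inc_neqp Ab Bb.
have cM : #|M| = q - 1.
  rewrite card_notin_seq ?(tri_pencil H) ?subSS //= ?inE ?bc //.
  by move=> m; rewrite !inE => /orP[] /eqP->.
have cN : #|N| = q - 1.
  rewrite card_notin_seq ?(tri_pencil H) ?subSS //= ?inE ?ac //.
  by move=> m; rewrite !inE => /orP[] /eqP->.
pose f z := xchoose (tri_meet H z.1 z.2).
have fP z : inc (f z) z.1 && inc (f z) z.2 by exact: xchooseP (tri_meet H z.1 z.2).
(* [m] meets [b] and [c] only in [A], and [n] meets [a] only in [B]; but p = A would force n = c,
   and p = B would force m = c. *)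
have goodf m n p : m \in M -> n \in N -> inc p m -> inc p n -> goodp p.
  rewrite !inE !negb_or => /and3P[Am mb mc] /and3P[Bn na nc] pm pn.
  have pA : p != A.
    by apply: contraNneq nc => E; rewrite E in pn; rewrite (line_eq AB pn Bn Ac Bc).
  have pB : p != B.
    by apply: contraNneq mc => E; rewrite E in pm; rewrite (line_eq AB Am pm Ac Bc).
  apply/and3P; split; apply/negP=> h.
  - by rewrite (line_eq pB pn Bn h Ba) eqxx in na.
  - by rewrite (line_eq pA pm Am h Ab) eqxx in mb.
  - by rewrite (line_eq pA pm Am h Ac) eqxx in mc.
have good_neq p : goodp p -> (p != A) /\ (p != B).
  by case/and3P=> pa pb pc; split; rewrite eq_sym; [exact: inc_neqp Ab pb | exact: inc_neqp Ba pa].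
rewrite -mulnn -{1}cM -cN -cardsX -(@card_in_imset _ _ f).
  apply: eq_card => p; rewrite inE; apply/idP/imsetP.
    move=> gp; have [pA pB] := good_neq _ gp; case/and3P: gp => pa pb pc.
    have [m /andP[pm Am]] := tri_join H p A.
    have [n /andP[pn Bn]] := tri_join H p B.
    have mb := inc_neql pm pb; have mc := inc_neql pm pc.
    have na := inc_neql pn pa; have nc := inc_neql pn pc.
    exists (m, n); first by rewrite !inE Am Bn !negb_or mb mc na nc.
    have mn : m != n.
      by apply: contraNneq mc => E; rewrite -E in Bn; rewrite (line_eq AB Am Bn Ac Bc).
    by have /andP[h1 h2] := fP (m, n); apply: point_eq mn pm pn h1 h2.
  case=> -[m n]; rewrite in_setX => /andP[hm hn] ->.
  by have /andP[h1 h2] := fP (m, n); apply: goodf hm hn h1 h2.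
move=> [m n] [m' n'] /setXP[hm hn] /setXP[hm' hn'] E.
have /andP[/= h1 h2] := fP (m, n); have /andP[/= h3 h4] := fP (m', n').
rewrite -E in h3 h4.
have [pA pB] := good_neq _ (goodf _ _ _ hm hn h1 h2).
move: hm hn hm' hn'; rewrite !inE => /andP[Am _] /andP[Bn _] /andP[Am' _] /andP[Bn' _].
by rewrite (line_eq pA h1 Am h3 Am') (line_eq pB h2 Bn h4 Bn').
Qed.

(** The line [ps] differs from [a], so it passes through [B] or [C] only if [s] is that vertex, and
    through [A] only if [s] is the trace [X] of [pA]. *)
Lemma visible_on_side p s m X : goodp p -> inc s a ->
  inc p m -> inc A m -> inc X m -> inc X a ->
  visible p s = (s \notin [:: B; C; X]).
Proof.
case/and3P=> pa pb pc sa pm Am Xm Xa; rewrite !inE !negb_or.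
have ps : s != p by exact: inc_neqp sa pa.
apply/existsP/and3P.
  case=> n /and3P[/and3P[An Bn Cn] pn sn]; split.
  - by apply: contraNneq Bn => <-.
  - by apply: contraNneq Cn => <-.
  - by apply: contraNneq An => E; subst X; rewrite (line_eq ps sn pn Xm pm).
case=> sB sC sX; have [n /andP[pn sn]] := tri_join H p s.
have na : n != a by exact: inc_neql pn pa.
exists n; rewrite pn sn !andbT; apply/and3P; split.
- apply: contraNN sX => An.
  have Em : n = m by apply: line_eq (inc_neqp Ab pb) An pn Am pm.
  by rewrite Em in na sn; apply/eqP; apply: point_eq na sn sa Xm Xa.
- by apply: contraNN na => Bn; rewrite (line_eq sB sn Bn sa Ba).
- by apply: contraNN na => Cn; rewrite (line_eq sC sn Cn sa Ca).
Qed.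

(** The excluded points [B], [C], [X], [Y], [Z] are distinct: [X] is no vertex because [l] is good;
    Y = B or Y = C would put [p] on [c] or [b]; Y = X would make [pA] equal to [l]; likewise for
    [Z]. Finally Y = Z would make [pA] and [rA] one line, again [l]. *)
Lemma card_visible_on_side p r l : goodp p -> goodp r -> goodl l ->
  p != r -> inc p l -> inc r l ->
  #|[set s | [&& ~~ inc s l, visible p s, visible r s & inc s a]]| = q - 4.
Proof.
move=> gp gr /and3P[Al Bl Cl] pr pl rl.
have [m /andP[pm Am]] := tri_join H p A.
have [n /andP[rn An]] := tri_join H r A.
have [X /andP[Xl Xa]] := tri_meet H l a.
have [Y /andP[Ym Ya]] := tri_meet H m a.
have [Z /andP[Zn Za]] := tri_meet H n a.
transitivity #|[set s in [set s | inc s a] | s \notin [:: B; C; X; Y; Z]]|.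
  apply: eq_card => s; rewrite !inE; case sa: (inc s a); last by rewrite !andbF.
  rewrite (visible_on_side gp sa pm Am Ym Ya) (visible_on_side gr sa rn An Zn Za).
  have ->: inc s l = (s == X).
    apply/idP/eqP=> [sl|->//].
    exact: point_eq (inc_neql Ba Bl) sa sl Xa Xl.
  by rewrite !inE; do 5!case: (s == _).
case/and3P: gp => pa pb pc; case/and3P: gr => ra rb rc.
have BX : B != X by rewrite eq_sym; exact: inc_neqp Xl Bl.
have CX : C != X by rewrite eq_sym; exact: inc_neqp Xl Cl.
have side t k T : ~~ inc t a -> ~~ inc t b -> ~~ inc t c ->
    inc t l -> inc t k -> inc A k -> inc T k -> inc T a ->
    [/\ B != T, C != T & X != T].
  move=> ta tb tc tl tk Ak Tk Ta; split; apply/negP=> /eqP E; subst T.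
  - by rewrite (line_eq (inc_neqp Ab Bb) Ak Tk Ac Bc) (negbTE tc) in tk.
  - by rewrite (line_eq (inc_neqp Ac Cc) Ak Tk Ab Cb) (negbTE tb) in tk.
  - by rewrite (line_eq (inc_neqp Xa ta) Tk tk Xl tl) (negbTE Al) in Ak.
have [BY CY XY] := side p m Y pa pb pc pl pm Am Ym Ya.
have [BZ CZ XZ] := side r n Z ra rb rc rl rn An Zn Za.
have YZ : Y != Z.
  apply: contraNneq Al => E; subst Z.
  have mn := line_eq (inc_neqp Ya Aa) Ym Am Zn An; subst n.
  by rewrite (line_eq pr pl rl pm rn).
have BC : B != C by exact: inc_neqp Bc Cc.
rewrite card_notin_seq ?(tri_line H) ?subSS //.
  by rewrite /= !inE !negb_or BC BX BY BZ CX CY CZ XY XZ YZ.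
by move=> s; rewrite !inE => /or4P[|||/orP[]] /eqP->.
Qed.

(* The intermediate point s is taken on the line m joining p to the point where
   rB meets b: then rB meets m only in a deleted point, so that s has to avoid
   just p and rC, which leaves q - 4 choices. *)
Lemma visible_path_vertex p r l : 4 < q -> goodp p -> goodp r -> p != r ->
  inc p l -> inc r l -> inc A l -> exists2 s, goodp s & visible p s && visible r s.
Proof.
move=> q4 /and3P[pa pb pc] /and3P[ra rb rc] pr pl rl Al.
have pA := inc_neqp Ab pb; have rA := inc_neqp Ab rb.
have [n /andP[rn Bn]] := tri_join H r B.
have [k /andP[rk Ck]] := tri_join H r C.
have [Y /andP[Yn Yb]] := tri_meet H n b.
have [m /andP[pm Ym]] := tri_join H p Y.
have ln : l != n.
  apply: contraNneq pc => E; rewrite E in Al pl.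
  by rewrite -(line_eq (inc_neqp Ab Bb) Al Bn Ac Bc).
have gm : goodl m.
  apply/and3P; split.
  - apply: contraNN rb => Am; have Em := line_eq pA Am pm Al pl.
    by rewrite Em in Ym; rewrite (point_eq ln rl rn Ym Yn).
  - apply: contraNN ln => Bm; have Em := line_eq (inc_neqp Yb Bb) Ym Bm Yn Bn.
    by rewrite Em in pm; rewrite (line_eq pr pl rl pm rn).
  - apply: contraNN pb => Cm; rewrite -(@line_eq C Y m b) //.
    apply: contraNneq ra => E; rewrite -E in Yn.
    by rewrite -(line_eq (inc_neqp Bc Cc) Bn Yn Ba Ca).
have [Z /andP[Zm Zk]] := tri_meet H m k.
have [s]: exists2 s, s \in [set s | goodp s & inc s m] & s \notin [:: p; Z].
  by apply: exists_notin_seq; rewrite card_good_on_line // ltn_subRL.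
rewrite !inE negb_or => /andP[gs sm] /andP[sp sZ].
have [Am Bm Cm] := and3P gm; have [sa sb sc] := and3P gs.
exists s => //; apply/andP; split; first by apply/existsP; exists m; rewrite gm pm.
have [h /andP[rh sh]] := tri_join H r s.
(* If [rs] passed through [A], it would be [l] and [s] would be [p]; through [B], [s] would be [Y],
   on side [b]; through [C], [s] would be [Z]. *)
apply/existsP; exists h; rewrite rh sh !andbT; apply/and3P; split.
- apply: contraNN sp => Ah; have Eh := line_eq rA Ah rh Al rl; rewrite Eh in sh.
  by rewrite (point_eq (inc_neql Al Am) sh sm pl pm).
- apply: contraNN sb => Bh.
  have Eh := line_eq (inc_neqp Ba ra) Bh rh Bn rn; rewrite Eh in sh.
  by rewrite (point_eq (inc_neql Bn Bm) sh sm Yn Ym).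
- apply: contraNN sZ => Ch.
  have Eh := line_eq (inc_neqp Ca ra) Ch rh Ck rk; rewrite Eh in sh.
  by rewrite (point_eq (inc_neql Ck Cm) sh sm Zk Zm).
Qed.

End Triangle.

Lemma visible_rot (P L : finType) (inc : P -> L -> bool) A B C p s :
  visible inc B C A p s = visible inc A B C p s.
Proof. by apply: eq_existsb => l; rewrite avoids_rot. Qed.

(** * Counts and paths for the whole triangle *)

Section TriangleCounts.
Variables (P L : finType) (inc : P -> L -> bool) (q : nat).
Variables (A B C : P) (a b c : L).
Hypothesis H : triangle_in_plane inc q A B C a b c.

Local Notation goodp := (avoids inc a b c).
Local Notation goodl := (avoids (dual inc) A B C).
Local Notation vis := (visible inc A B C).

Lemma card_good_through p : goodp p -> #|[set l | goodl l & inc p l]| = q - 2.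
Proof. exact: card_good_on_line (triangle_dual H) p. Qed.

(** This gives connectivity. If [p] and [r] coincide or their join is good, s = p works; otherwise
    the join contains a vertex, which a rotation turns into [A]. *)
Lemma visible_path p r : 4 < q -> goodp p -> goodp r ->
  exists2 s, goodp s & vis p s && vis r s.
Proof.
move=> q4 gp gr; have [pr|pr] := eqVneq p r.
  subst r; exists p => //; rewrite andbb.
  have: 0 < #|[set l | goodl l & inc p l]|.
    by rewrite card_good_through // subn_gt0 (ltn_trans _ q4).
  case/card_gt0P=> l; rewrite inE => /andP[gl pl].
  by apply/existsP; exists l; rewrite gl pl.
have [l /andP[pl rl]] := tri_join H p r.
case gl: (goodl l).
  by exists p => //; apply/andP; split; apply/existsP; exists l; rewrite gl pl ?rl.
have H1 := triangle_rot H; have H2 := triangle_rot H1.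
move: gl => /negbT; rewrite !negb_and !negbK => /or3P[] hl.
- exact: visible_path_vertex H p r l q4 gp gr pr pl rl hl.
- have [||s] := visible_path_vertex H1 q4 _ _ pr pl rl hl;
    rewrite ?(avoids_rot inc a b c) // => gs.
  by rewrite !(visible_rot inc A B C); exists s.
- have [||s] := visible_path_vertex H2 q4 _ _ pr pl rl hl;
    rewrite -?(avoids_rot inc c a b) // => gs.
  by rewrite -!(visible_rot inc C A B); exists s.
Qed.

(** Intersecting [m] and [n] is a bijection from pairs of good lines other than [l] through [p] and
    [r] to these points [s]; its inverse joins [s] to [p] and to [r]. *)
Lemma card_visible_from_both p r l : goodp p -> goodp r -> goodl l ->
  p != r -> inc p l -> inc r l ->
  #|[set s | [&& ~~ inc s l, vis p s & vis r s]]| = (q - 3) ^ 2.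
Proof.
move=> gp gr gl pr pl rl.
pose M t := [set m | goodl m & inc t m] :\ l.
have cM t : goodp t -> inc t l -> #|M t| = q - 3.
  move=> gt tl; have := cardsD1 l [set m | goodl m & inc t m].
  rewrite card_good_through // inE gl tl -/(M t) => /(congr1 (subn^~ 1)).
  by rewrite addKn -subnDA.
pose f z := xchoose (tri_meet H z.1 z.2).
have fP z : inc (f z) z.1 && inc (f z) z.2 by exact: xchooseP (tri_meet H z.1 z.2).
have offl m n s : m \in M p -> n \in M r -> inc s m -> inc s n -> ~~ inc s l.
  rewrite !inE => /and3P[ml _ pm] /and3P[nl _ rn] sm sn.
  apply: contraNN pr => sl.
  by rewrite -(point_eq H ml sm sl pm pl) (point_eq H nl sn sl rn rl).
rewrite -mulnn -{1}(cM p) // -(cM r) // -cardsX -(@card_in_imset _ _ f).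
  apply: eq_card => s; rewrite inE; apply/idP/imsetP.
    case/and3P=> sl /existsP[m /and3P[gm pm sm]] /existsP[n /and3P[gn rn sn]].
    have ml : m != l by apply: inc_neql sm sl.
    have nl : n != l by apply: inc_neql sn sl.
    exists (m, n); first by rewrite !inE ml nl gm gn pm rn.
    have mn : m != n.
      by apply: contraNneq ml => E; rewrite -E in rn; rewrite (line_eq H pr pm rn pl rl).
    by have /andP[h1 h2] := fP (m, n); apply: (point_eq H) mn sm sn h1 h2.
  case=> -[m n]; rewrite in_setX => /andP[hm hn] ->.
  have /andP[h1 h2] := fP (m, n); rewrite (offl m n) //=.
  move: hm hn; rewrite !inE => /and3P[_ gm pm] /and3P[_ gn rn].
  by apply/andP; split; apply/existsP; [exists m; rewrite gm pm | exists n; rewrite gn rn].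
move=> [m n] [m' n'] /setXP[hm hn] /setXP[hm' hn'] E.
have /andP[/= h1 h2] := fP (m, n); have /andP[/= h3 h4] := fP (m', n').
rewrite -E in h3 h4.
have sl := offl _ _ _ hm hn h1 h2.
have sp := inc_neqp pl sl; have sr := inc_neqp rl sl.
move: hm hn hm' hn'; rewrite !inE => /and3P[_ _ Am] /and3P[_ _ Bn] /and3P[_ _ Am'] /and3P[_ _ Bn'].
by rewrite (line_eq H sp Am h1 Am' h3) (line_eq H sr Bn h2 Bn' h4).
Qed.

(* A vertex of the triangle is never visible, so a visible point that is not
   good lies on exactly one side. *)
Lemma card_good_visible_from_both p r l : 4 < q ->
  goodp p -> goodp r -> goodl l -> p != r -> inc p l -> inc r l ->
  #|[set s | goodp s & [&& ~~ inc s l, vis p s & vis r s]]| = q ^ 2 + 21 - 9 * q.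
Proof.
move=> q4 gp gr gl pr pl rl.
have cS := card_visible_from_both gp gr gl pr pl rl.
have ca := card_visible_on_side H gp gr gl pr pl rl.
have H1 := triangle_rot H; have H2 := triangle_rot H1.
have cb : #|[set s | [&& ~~ inc s l, vis p s, vis r s & inc s b]]| = q - 4.
  rewrite -(card_visible_on_side H1 _ _ _ pr pl rl) 1?avoids_rot //.
  by apply: eq_card => s; rewrite !inE !(visible_rot inc A B C).
have cc : #|[set s | [&& ~~ inc s l, vis p s, vis r s & inc s c]]| = q - 4.
  rewrite -(card_visible_on_side H2 _ _ _ pr pl rl) -1?avoids_rot //.
  by apply: eq_card => s; rewrite !inE -!(visible_rot inc C A B).
pose S := [set s | [&& ~~ inc s l, vis p s & vis r s]].
have cP (Q : pred P) : \sum_(s in S) Q s = #|[set s | Q s & s \in S]|.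
  rewrite -sum1_card [RHS](eq_bigl (fun s => (s \in S) && Q s)); last first.
    by move=> s; rewrite inE andbC.
  by rewrite big_mkcondr; apply: eq_bigr => s _; case: (Q s).
(* Exactly one of the four indicators is 1 at each [s] in [S]: two sides at once would make [s] a
   vertex, and no good line contains one. *)
have split4: #|S| = \sum_(s in S) (goodp s + inc s a + inc s b + inc s c).
  rewrite -sum1_card; apply: eq_bigr => s; rewrite inE.
  case/and3P=> _ /existsP[m /and3P[/and3P[Am Bm Cm] _ sm]] _.
  have [Ab Ac Bc Ba /andP[Ca Cb]] := and5P (tri_vertices H).
  have [Aa Bb Cc] := and3P (tri_proper H).
  rewrite /avoids; case sa: (inc s a); case sb: (inc s b); case sc: (inc s c) => //.
  - by rewrite (point_eq H (inc_neql Ba Bb) sa sb Ca Cb) (negbTE Cm) in sm.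
  - by rewrite (point_eq H (inc_neql Ba Bb) sa sb Ca Cb) (negbTE Cm) in sm.
  - by rewrite (point_eq H (inc_neql Ca Cc) sa sc Ba Bc) (negbTE Bm) in sm.
  - by rewrite (point_eq H (inc_neql Cb Cc) sb sc Ab Ac) (negbTE Am) in sm.
have cside x : \sum_(s in S) inc s x =
    #|[set s | [&& ~~ inc s l, vis p s, vis r s & inc s x]]|.
  by rewrite (cP (inc^~ x)); apply: eq_card => s; rewrite !inE andbC -!andbA.
rewrite cS !big_split /= !cside ca cb cc (cP goodp) in split4.
have ->: [set s | goodp s & [&& ~~ inc s l, vis p s & vis r s]] =
         [set s | goodp s & s \in S] by apply/setP=> s; rewrite !inE.
move: split4; set N := #|_|; move: N => N; rewrite -!mulnn.
(* Substituting q = t + 5 lets [lia] resolve the truncated subtractions. *)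
have [t ->]: exists t, q = t + 5 by exists (q - 5); rewrite subnK.
by lia.
Qed.

End TriangleCounts.

(** * Triangles in a projective plane *)

(** Three points of the quadrangle are the vertices and their joins the sides. Pencil sizes, and
    joins and meets of equal elements, remain to be derived from the axioms. *)
Lemma plane_has_triangle (P L : finType) (inc : P -> L -> bool) (q : nat) :
  projective_plane inc -> plane_order inc q ->
  exists A B C a b c, triangle_in_plane inc q A B C a b c.
Proof.
case=> hj hm [Q [cQ hQ]] ho.
have [A [B [C [AQ BQ CQ [AB AC BC]]]]]: exists A B C : P,
    [/\ A \in Q, B \in Q, C \in Q & [/\ A != B, A != C & B != C]].
  have: 2 < #|Q| by rewrite cQ.
  by case/card_gt2P=> A [B [C [[? ? ?] [? ? ?]]]]; exists A, B, C; split=> //; split=> //; rewrite eq_sym.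
have noncol l : ~~ [&& inc A l, inc B l & inc C l].
  apply/negP=> /and3P[Al Bl Cl].
  suff: 2 < #|[set p in Q | inc p l]| by rewrite ltnNge hQ.
  by apply/card_gt2P; exists A, B, C; rewrite !inE AQ BQ CQ Al Bl Cl AB BC eq_sym AC.
have [a [[Ba Ca] _]] := hj _ _ BC.
have [b [[Ab Cb] _]] := hj _ _ AC.
have [c [[Ac Bc] _]] := hj _ _ AB.
have Aa : ~~ inc A a by have := noncol a; rewrite Ba Ca !andbT.
have Bb : ~~ inc B b by have := noncol b; rewrite Ab Cb !andbT.
have Cc : ~~ inc C c by have := noncol c; rewrite Ac Bc.
have lin p r l m : inc p l -> inc p m -> inc r l -> inc r m -> p = r \/ l = m.
  move=> pl pm rl rm; have [|pr] := eqVneq p r; first by left.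
  by right; have [n [_ un]] := hj _ _ pr; rewrite -(un l) // -(un m).
(* A point on both [a] and [b] is [C], which is off [c]. *)
have offline p : exists l, ~~ inc p l.
  have [pa|] := boolP (inc p a); last by exists a.
  have [pb|] := boolP (inc p b); last by exists b.
  exists c; case: (lin _ _ _ _ pa pb Ca Cb) => [->//|E].
  by rewrite -E Ba in Bb.
have join p r : exists l, inc p l && inc r l.
  have [<-|pr] := eqVneq p r; last first.
    by have [l [[pl rl] _]] := hj _ _ pr; exists l; rewrite pl.
  have [pA|pA] := eqVneq p A; first by exists b; rewrite pA Ab.
  by have [l [[pl _] _]] := hj _ _ pA; exists l; rewrite pl.
have meet l m : exists p, inc p l && inc p m.
  have [<-|lm] := eqVneq l m; last first.
    by have [p [[pl pm] _]] := hm _ _ lm; exists p; rewrite pl.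
  have: 0 < #|[set p | inc p l]| by rewrite ho.
  by case/card_gt0P=> p; rewrite inE => pl; exists p; rewrite pl.
exists A, B, C, a, b, c; split=> //.
- move=> p; have [l pl] := offline p.
  (* Joining to [p] maps the points of a line [l] missing [p] bijectively onto the pencil at [p]. *)
  pose f r := xchoose (join p r).
  have fP r : inc p (f r) && inc r (f r) by exact: xchooseP (join p r).
  rewrite -(ho l) -(@card_in_imset _ _ f).
    apply: eq_card => m; rewrite inE; apply/idP/imsetP.
      move=> pm; have [r /andP[rl rm]] := meet l m.
      exists r; rewrite ?inE //; have /andP[h1 h2] := fP r.
      by case: (lin _ _ _ _ pm h1 rm h2) => // E; rewrite E rl in pl.
    by case=> r _ ->; case/andP: (fP r).
  move=> r s; rewrite !inE => rl sl E.
  have /andP[h1 h2] := fP r; have /andP[h3 h4] := fP s; rewrite -E in h4.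
  by case: (lin _ _ _ _ rl h2 sl h4) => // El; rewrite El h1 in pl.
- by rewrite Ab Ac Bc Ba Ca.
- by rewrite Aa Bb.
Qed.

(* Subtraction on nat is truncated, so q^2 - 9q + 21 is written with the
   subtraction last; 9q <= q^2 + 21 holds for every natural number q. *)
Theorem theorem2p5 (q : nat) (hq : 4 < q)
  (hplane : exists (P L : finType) (inc : P -> L -> bool),
      projective_plane inc /\ plane_order inc q) :
  exists (V : finType) (e : rel V),
    bipartite e /\
    edge_girth_regular e (2 * (q - 1) ^ 2) (q - 2) 6
      ((q - 3) * (q ^ 2 + 21 - 9 * q)).
Proof.
have [P [L [inc [hp ho]]]] := hplane.
have [A [B [C [a [b [c H]]]]]] := plane_has_triangle hp ho.
pose goodp := avoids inc a b c; pose goodl := avoids (dual inc) A B C.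
pose I (x : {p | goodp p}) (y : {l | goodl l}) := inc (val x) (val y).
have linI x1 x2 y1 y2 : I x1 y1 -> I x1 y2 -> I x2 y1 -> I x2 y2 -> x1 = x2 \/ y1 = y2.
  move=> h1 h2 h3 h4.
  by case: (tri_linear H h1 h2 h3 h4) => E; [left | right]; apply: val_inj.
have colI x y : collinear I x y = visible inc A B C (val x) (val y).
  apply/existsP/existsP.
    by case=> l /andP[xl yl]; exists (val l); apply/and3P; split=> //; exact: (valP l).
  by case=> l /and3P[gl xl yl]; exists (Sub l gl); apply/andP.
have degl (y : {l | goodl l}) : #|[set x | I x y]| = q - 2.
  by rewrite (@card_sig_set _ goodp (inc^~ (val y))) (card_good_on_line H) //; exact: valP.
have degp (x : {p | goodp p}) : #|[set y | I x y]| = q - 2.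
  by rewrite (@card_sig_set _ goodl (inc (val x))) (card_good_through H) //; exact: valP.
have q2 : 0 < q - 2 by rewrite subn_gt0 (ltn_trans _ hq).
pose e := incidence_rel I.
have lambda_flag x y : I x y ->
    #|[set D in cycles_of_length e 6 | [set inl x; inr y] \in D]| =
    (q - 3) * (q ^ 2 + 21 - 9 * q).
  move=> xy; rewrite (card_cycles_through _ _ _ (incidence_sym I)) card_hexagons //.
  rewrite (eq_bigr (fun=> q ^ 2 + 21 - 9 * q)).
    (* The factor q - 3 counts the good points of [y] other than [x]. *)
    rewrite sum_nat_const; congr (_ * _).
    have := cardsD1 x [set r | I r y]; rewrite degl inE xy => /(congr1 (subn^~ 1)).
    rewrite addKn -subnDA => ->.
    by apply: eq_card => r; rewrite !inE.
  move=> r /andP[rx ry].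
  rewrite -(card_good_visible_from_both H hq (valP x) (valP r) (valP y) _ xy ry); last first.
    by rewrite (inj_eq val_inj) eq_sym.
  rewrite -(@card_sig_set _ goodp (fun s => [&& ~~ inc s (val y),
    visible inc A B C (val x) s & visible inc A B C (val r) s])).
  apply: eq_card => s.
  by rewrite !inE !colI.
have lambda_edge u v : e u v ->
    #|[set D in cycles_of_length e 6 | [set u; v] \in D]| =
    (q - 3) * (q ^ 2 + 21 - 9 * q).
  case: u v => [x|y] [x'|y'] //=; first exact: lambda_flag.
  by rewrite setUC; exact: lambda_flag.
have card_points : #|{: {p | goodp p}}| = (q - 1) ^ 2.
  by rewrite card_sig -(card_good_points H) cardsE.
have card_lines : #|{: {l | goodl l}}| = (q - 1) ^ 2.
  by rewrite card_sig -(card_good_points (triangle_dual H)) cardsE.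
exists _, e; split; first exact: incidence_bipartite.
split.
- exact: incidence_simple.
- apply: incidence_connected => [y|x x'].
    have: 0 < #|[set x | I x y]| by rewrite degl.
    by case/card_gt0P=> x; rewrite inE; exists x.
  have [s gs /andP[]] := visible_path H hq (valP x) (valP x').
  (* Viewing [s] as a vertex of the graph lets [colI] turn visibility into the walk
     [x, y, s, y', x']. *)
  rewrite -[s]/(val (Sub s gs : {p | goodp p})) -!colI.
  case/existsP=> y /andP[xy sy] /existsP[y' /andP[xy' sy']].
  have step u v : e u v -> connect e u v by exact: connect1.
  apply: connect_trans (step (inl x) (inr y) xy) _.
  apply: connect_trans (step (inr y) (inl (Sub s gs)) sy) _.
  apply: connect_trans (step (inl (Sub s gs)) (inr y') sy') _.
  exact: step (inr y') (inl x') xy'.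
- by rewrite card_sum card_points card_lines mul2n addnn.
- exact: incidence_regular.
- split; last exact: incidence_girth_ge6.
  have: 0 < #|{: {p | goodp p}}|.
    by rewrite card_points expn_gt0 subn_gt0 (ltn_trans _ hq).
  case/card_gt0P=> x _; have: 0 < #|[set y | I x y]| by rewrite degp.
  case/card_gt0P=> y; rewrite inE => xy.
  (* A hexagon exists because the count through a flag is positive: for q = t + 5 its second factor
     is t^2 + t + 1. *)
  have: 0 < #|[set D in cycles_of_length e 6 | [set inl x; inr y] \in D]|.
    rewrite lambda_flag //.
    have [t ->]: exists t, q = t + 5 by exists (q - 5); rewrite subnK.
    by rewrite -mulnn; lia.
  case/card_gt0P=> D; rewrite inE => /andP[/imsetP[d]].
  by rewrite inE => hd _ _; exists (val d); rewrite ?size_tuple.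
- exact: lambda_edge.
Qed.
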